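(* Let $H$ be a complex Hilbert space and let $A$ be a standard $C^*$-algebra on $H$, i.e. a $C^*$-algebra with $\mathcal{K}(H)\subseteq A\subseteq \mathcal{L}(H)$. Let $E$ and $F$ be Hilbert $A$-modules, and let $\Psi: E\to F$ be a $\mathbb{C}$-linear map (not assumed to be bounded) that is local, i.e. $\Psi(x)a=0$ whenever $x\in E$, $a\in A$ and $xa=0$, and orthogonality preserving, i.e. $\langle\Psi(x),\Psi(y)\rangle=0$ whenever $x,y\in E$ and $\langle x,y\rangle=0$. Then there is $\lambda\in\mathbb{R}_+=[0,\infty)$ such that $$\langle \Psi(x),\Psi(y)\rangle = \lambda\langle x,y\rangle\qquad (x,y\in E).$$
   Context: Hilbert $A$-modules are right Hilbert $C^*$-modules over $A$, with $A$-valued inner product $\langle\cdot,\cdot\rangle$ that is conjugate-linear in the first variable and satisfies $\langle x, ya\rangle = \langle x,y\rangle a$. $\mathcal{K}(H)$ and $\mathcal{L}(H)$ denote the compact and the bounded linear operators on $H$. *)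

(* Defs.v *)
From HB Require Import structures.
From mathcomp Require Import all_boot all_order all_algebra.
From mathcomp Require Import sesquilinear complex.
From mathcomp Require Import all_classical all_reals topology normedtype.

Set Implicit Arguments.
Unset Strict Implicit.
Unset Printing Implicit Defensive.

Import Order.TTheory GRing.Theory Num.Theory.
Import numFieldNormedType.Exports.

Local Open Scope classical_set_scope.
Local Open Scope complex_scope.
Local Open Scope ring_scope.

(* Following the library's hermitian forms, [hs_dot] is linear in its first
   variable and conjugate-linear in the second.  Norms of complex normed
   modules take their values in [R[i]]. *)
Record hilbertSpace (R : realType) := HilbertSpace {
  hs_carrier :> completeNormedModType R[i];
  hs_dot : {dot hs_carrier for Num.conj};
  hs_normE : forall v : hs_carrier, `|v| ^+ 2 = hs_dot v v
}.

Section Operators.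
Variables (R : realType) (H : hilbertSpace R).
Implicit Types (T S : H -> H) (A : set (H -> H)).

Definition bounded_op : set (H -> H) :=
  [set T | linear T /\ exists M : R[i], forall v, `|T v| <= M * `|v|].

Definition compact_op : set (H -> H) :=
  [set T | linear T /\ precompact (T @` [set v | `|v| <= 1])].

(* Only meaningful on [bounded_op]: [sup] of an unbounded set is 0. *)
Definition opnorm T : R := sup [set complex.Re `|T v| | v in [set v | `|v| <= 1]].

Definition adjoint_op T S : Prop :=
  forall v w, hs_dot H (T v) w = hs_dot H v (S w).

(* A C*-algebra contained in L(H), possibly without unit; sums and scalar
   multiples are the pointwise ones on [H -> H]. *)
Record cstar_algebra_on A : Prop := CstarAlgebraOn {
  cstar_bounded : A `<=` bounded_op;
  cstar0 : A 0;
  cstarD : forall a b, A a -> A b -> A (a + b);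
  cstarZ : forall (k : R[i]) a, A a -> A (k *: a);
  cstarM : forall a b, A a -> A b -> A (a \o b);
  cstar_adj : forall a, A a -> exists2 b, A b & adjoint_op a b;
  cstar_closed : forall T, bounded_op T ->
    (forall e : R, 0 < e -> exists2 a, A a & opnorm (T - a) < e) -> A T
}.

Definition standard_cstar_algebra A : Prop :=
  cstar_algebra_on A /\ compact_op `<=` A.

(* a = b^* b for some b in A *)
Definition cstar_positive A : set (H -> H) :=
  [set a | exists b c, [/\ A b, A c, adjoint_op b c & a = c \o b]].

(* The action [hm_act] is a total function, but it is only constrained (and only
   used) on elements of [A].  [hm_normE] says that the norm of the Banach space
   underlying the module is || <x, x> ||^(1/2). *)
Record hilbertModule A := HilbertModule {
  hm_carrier :> completeNormedModType R[i];
  hm_act : hm_carrier -> (H -> H) -> hm_carrier;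
  hm_ip : hm_carrier -> hm_carrier -> (H -> H);
  hm_actDl : forall x y a, A a -> hm_act (x + y) a = hm_act x a + hm_act y a;
  hm_actDr : forall x a b, A a -> A b ->
    hm_act x (a + b) = hm_act x a + hm_act x b;
  hm_actZl : forall (k : R[i]) x a, A a -> hm_act (k *: x) a = k *: hm_act x a;
  hm_actZr : forall (k : R[i]) x a, A a -> hm_act x (k *: a) = k *: hm_act x a;
  hm_actM : forall x a b, A a -> A b ->
    hm_act x (a \o b) = hm_act (hm_act x a) b;
  hm_ipA : forall x y, A (hm_ip x y);
  hm_ip_linear : forall x (k : R[i]) y z,
    hm_ip x (k *: y + z) = k *: hm_ip x y + hm_ip x z;
  hm_ip_act : forall x y a, A a -> hm_ip x (hm_act y a) = hm_ip x y \o a;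
  hm_ip_adj : forall x y, adjoint_op (hm_ip x y) (hm_ip y x);
  hm_ip_ge0 : forall x, cstar_positive A (hm_ip x x);
  hm_ip_eq0 : forall x, hm_ip x x = 0 -> x = 0;
  hm_normE : forall x, `|x| ^+ 2 = (opnorm (hm_ip x x))%:C
}.

Definition local_map A (E F : hilbertModule A) (Psi : E -> F) : Prop :=
  forall (x : E) a, A a -> hm_act x a = 0 -> hm_act (Psi x) a = 0.

Definition orthogonality_preserving A (E F : hilbertModule A)
    (Psi : E -> F) : Prop :=
  forall x y : E, hm_ip x y = 0 -> hm_ip (Psi x) (Psi y) = 0.

End Operators.

(* Main.v *)
(** Fix a nonzero vector [v] of [H] and write [theta u v] for the rank one
    operator [p |-> <p, v> u], which lies in [A].  Locality makes [Psi] commute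
    with the idempotents of [A], hence with the operators [theta u v]: these are
    multiples of idempotents when [<u, v> <> 0], and otherwise
    [theta u v = theta (u + v) v - theta v v].  The scalar forms
    [s x y = (<x, y> v, v)] and [t x y = (<Psi x, Psi y> v, v)] are the essential
    entries of [<x theta, y theta>] and [<Psi x theta, Psi y theta>] for
    [theta = theta v v], so [s x y = 0] implies [t x y = 0], and linear algebra
    gives [t = lambda s].  Evaluating this equality at [x (theta u v)] and
    [y (theta w v)] recovers every matrix entry [(<x, y> w, u)]. *)

Require Import Defs.
From HB Require Import structures.
From mathcomp Require Import all_boot all_order all_algebra.
From mathcomp Require Import sesquilinear complex.
From mathcomp Require Import ring.
From mathcomp Require Import all_classical all_reals topology normedtype.

Set Implicit Arguments.
Unset Strict Implicit.
Unset Printing Implicit Defensive.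

Import Order.TTheory GRing.Theory Num.Theory.
Import numFieldNormedType.Exports.
Local Open Scope classical_set_scope.
Local Open Scope complex_scope.
Local Open Scope ring_scope.

(** * Compactness of rank one operators *)

Lemma real_complex_continuous (R : realType) :
  continuous ((fun x : R => x%:C) : R -> R[i]^o).
Proof.
move=> x; apply/cvgrPdist_lt => e; rewrite ltcE => /andP[/eqP eI eR].
apply: filterS (nbhsx_ballx x (complex.Re e) eR) => t xt.
rewrite -rmorphB normc_def /= expr0n /= addr0 sqrtr_sqr.
by rewrite ltcE /= eI eqxx.
Qed.

(** The disk lies in the square [[-M, M]] x [[-M, M]], whose image under a continuous map is
    compact. *)
Lemma complex_disk_scale_precompact (R : realType) (V : normedModType R[i])
    (M : R) (u : V) :
  precompact [set c *: u | c in [set c : R[i] | `|c| <= M%:C]].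
Proof.
pose f (z : R * R) : V := (z.1%:C + 'i%C * z.2%:C) *: u.
have f_cont : continuous f.
  move=> z; apply: (@continuousZr_tmp _ _ _
    (fun z : R * R => z.1%:C + 'i%C * z.2%:C : R[i]^o)).
  apply: (@continuousD _ R[i]^o).
    apply: continuous_comp; [exact: cvg_fst | exact: real_complex_continuous].
  apply: (@continuousM R[i]); first exact: cvg_cst.
  apply: continuous_comp; [exact: cvg_snd | exact: real_complex_continuous].
apply: (@precompact_subset _ _ (f @` (`[-M, M] `*` `[-M, M]))); last first.
  apply: compact_precompact; first exact: norm_hausdorff.
  apply: continuous_compact; first exact: continuous_subspaceT.
  by apply: compact_setX; exact: segment_compact.
move=> _ [c /= cM <-]; exists (complex.Re c, complex.Im c); last first.
  by rewrite /f /= -complexE.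
have bound (a b : R) : Num.sqrt (a ^+ 2 + b ^+ 2) <= M -> -M <= a <= M.
  move=> abM; rewrite -ler_norml -sqrtr_sqr; apply: le_trans abM.
  by rewrite ler_wsqrtr // lerDl sqr_ge0.
move: cM; rewrite normc_def lecR => cM.
by split; rewrite /= in_itv /=; [|rewrite addrC in cM]; exact: bound cM.
Qed.

Definition rank_one (R : realType) (H : hilbertSpace R) (u v : H) : H -> H :=
  fun p => hs_dot H p v *: u.

Section RankOne.
Variables (R : realType) (H : hilbertSpace R).
Implicit Types p u v : H.

Lemma dot_cauchy_schwarz p v :
  `|hs_dot H p v| ^+ 2 <= hs_dot H p p * hs_dot H v v.
Proof.
have [->|v0] := eqVneq v 0; first by rewrite !linear0r normr0 expr0n /= mulr0.
have n0 : 0 < hs_dot H v v by rewrite dnorm_gt0.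
(* This is [<v, v>] times the component of [p] orthogonal to [v], scaled to avoid a division. *)
have := dnorm_ge0 (hs_dot H) (hs_dot H v v *: p - hs_dot H p v *: v).
rewrite dnormB !dnormZ linearZl_LR linearZr_LR /=.
set n := hs_dot H v v in n0 *; set c := hs_dot H p v.
rewrite !rmorphM /= conjCK (CrealP (gtr0_real n0)) (gtr0_norm n0).
have -> : n ^+ 2 * hs_dot H p p + `|c| ^+ 2 * n -
    (n * (c^* * c) + n * (c * c^*)) = n * (hs_dot H p p * n - `|c| ^+ 2).
  rewrite normCK; ring.
by rewrite pmulr_rge0 // subr_ge0.
Qed.

Lemma rank_one_linear u v : linear (rank_one u v).
Proof. by move=> k p q; rewrite /rank_one linearPl scalerDl scalerA. Qed.

Lemma rank_one_compact u v : compact_op (rank_one u v).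
Proof.
split; first exact: rank_one_linear.
apply: (@precompact_subset _ _
  [set c *: u | c in [set c : R[i] | `|c| <= (complex.Re `|v|)%:C]]);
  last exact: complex_disk_scale_precompact.
move=> _ [p /= p1 <-]; exists (hs_dot H p v) => //=.
rewrite RRe_real ?normr_real // -(ler_pXn2r (n := 2)) ?nnegrE //.
apply: le_trans (dot_cauchy_schwarz p v) _.
by rewrite -!hs_normE ler_piMl ?exprn_ge0 // exprn_ile1.
Qed.

Lemma rank_oneDl u u' v : rank_one (u + u') v = rank_one u v + rank_one u' v.
Proof. by apply/funext => p; rewrite /rank_one scalerDr. Qed.
End RankOne.

(** * Sesquilinear forms with nested zero sets *)

Section SesquilinearProportional.
Variables (C : numClosedFieldType) (V : lmodType C).

Definition sesquilinear_form (s : V -> V -> C) :=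
  (forall x, scalar (s x)) /\
  (forall y k x x', s (k *: x + x') y = k^* * s x y + s x' y).

Variables (s d : V -> V -> C).
Hypotheses (s_form : sesquilinear_form s) (d_form : sesquilinear_form d).
Hypothesis s0d0 : forall x y, s x y = 0 -> d x y = 0.

(** A multiple of [y0] added to [y] makes [s x0 y] vanish and leaves [d x0 y] unchanged, so [d]
    vanishes on the row of [x0], and likewise on the column of [y0]. *)
Lemma sesquilinear_form_eq0 x0 y0 :
  s x0 y0 != 0 -> d x0 y0 = 0 -> forall x y, d x y = 0.
Proof.
case: s_form d_form => sr sl [dr dl] c0 d0.
have drow y : d x0 y = 0.
  have := @s0d0 x0 (- (s x0 y / s x0 y0) *: y0 + y).
  by rewrite sr dr d0 mulr0 add0r mulNr divfK // addNr => ->.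
have dcol x : d x y0 = 0.
  have := @s0d0 (- (s x y0 / s x0 y0)^* *: x0 + x) y0.
  by rewrite sl dl d0 mulr0 add0r rmorphN /= conjCK mulNr divfK // addNr => ->.
move=> x y.
(* Replacing [x] by [x + x0] if necessary makes [s x y0] nonzero; then a
   multiple of [y0] added to [y] makes [s x y] vanish. *)
wlog sx0 : x / s x y0 != 0 => [gen|].
  have [sx|/eqP sx] := eqVneq (s x y0) 0; last exact/gen/eqP.
  have := dl y 1 x0 x; rewrite scale1r drow mulr0 add0r => <-; apply: gen.
  by have := sl y0 1 x0 x; rewrite scale1r sx addr0 rmorph1 mul1r => ->.
have := @s0d0 x (- (s x y / s x y0) *: y0 + y).
by rewrite sr dr dcol mulr0 add0r mulNr divfK // addNr => ->.
Qed.
End SesquilinearProportional.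

(** Polarization: expanding [s] at [k *: x + y], [k = 1] gives antisymmetry and [k = 'i] then gives
    [2 'i s x y = 0]. *)
Lemma sesquilinear_form_polar (C : numClosedFieldType) (V : lmodType C)
    (s : V -> V -> C) :
  sesquilinear_form s -> (forall x, s x x = 0) -> forall x y, s x y = 0.
Proof.
move=> [sr sl] s0 x y.
have polar k : k * s y x + k^* * s x y = 0.
  by have := s0 (k *: x + y); rewrite sl !sr !s0 mulr0 add0r addr0 addrC.
have := polar 1; rewrite rmorph1 !mul1r => /eqP; rewrite addr_eq0 => /eqP sC.
have := polar 'i; rewrite conjCi sC mulrN -mulNr -mulrDl => /eqP.
by rewrite mulf_eq0 -opprD oppr_eq0 -mulr2n mulrn_eq0 (negPf (neq0Ci C)) => /eqP.
Qed.

(** * Matrix entries of module inner products *)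

Section HilbertModule.
Variables (R : realType) (H : hilbertSpace R) (A : set (H -> H)).
Variable (hA : standard_cstar_algebra A).

Let Arank1 (u v : H) : A (rank_one u v).
Proof. by apply: hA.2; exact: rank_one_compact. Qed.

Section Module.
Variable (E : hilbertModule A).
Implicit Types (x y : E).

(** Weak form of [<x a, y b> = a^* <x, y> b], which avoids naming the adjoint of [a]. *)
Lemma dot_ip_act x y a b (p q : H) : A a -> A b ->
  hs_dot H (hm_ip (hm_act x a) (hm_act y b) p) q =
  hs_dot H (hm_ip x y (b p)) (a q).
Proof. by move=> Aa Ab; rewrite hm_ip_act //= hm_ip_adj hm_ip_act //= -hm_ip_adj. Qed.

Lemma hm_ipZ_op x y (k : R[i]) (w : H) : hm_ip x y (k *: w) = k *: hm_ip x y w.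
Proof.
have [ip_lin _] := cstar_bounded hA.1 (hm_ipA x y).
have ip0 : hm_ip x y 0 = 0.
  by have := ip_lin (-1) 0 0; rewrite !scaleN1r !addNr.
by have := ip_lin k w 0; rewrite ip0 !addr0.
Qed.

Lemma dot_ip_rank_one x y (u w v p q : H) :
  hs_dot H (hm_ip (hm_act x (rank_one u v)) (hm_act y (rank_one w v)) p) q =
  hs_dot H p v * (hs_dot H q v)^* * hs_dot H (hm_ip x y w) u.
Proof.
by rewrite dot_ip_act // /rank_one hm_ipZ_op linearZl_LR linearZr_LR /= mulrA.
Qed.

Lemma hm_ip0 x : hm_ip x (0 : E) = 0.
Proof. by have := hm_ip_linear x (-1) x x; rewrite !scaleN1r !addNr. Qed.

Lemma hm_actBr x a b : A a -> A b -> hm_act x (a - b) = hm_act x a - hm_act x b.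
Proof.
move=> Aa Ab; rewrite -scaleN1r hm_actDr ?hm_actZr ?scaleN1r //.
by rewrite -scaleN1r; apply: cstarZ hA.1 _ _ _.
Qed.

Lemma hm_actBl x y a : A a -> hm_act (x - y) a = hm_act x a - hm_act y a.
Proof. by move=> Aa; rewrite -scaleN1r hm_actDl ?hm_actZl ?scaleN1r. Qed.

(** Since [A] may lack a unit, [y] is tested on [rank_one p p], which sends [p] to a nonzero
    multiple of itself when [p != 0]. *)
Lemma hm_act_eq0 y : (forall a, A a -> hm_act y a = 0) -> y = 0.
Proof.
move=> ya0; apply: hm_ip_eq0; apply/funext => p /=.
have [->|p0] := eqVneq p 0; first by have := hm_ipZ_op y y 0 0; rewrite !scale0r.
have := hm_ip_act y y (Arank1 p p); rewrite ya0 // hm_ip0 => /(congr1 (@^~ p)).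
rewrite /rank_one /= hm_ipZ_op => /esym/eqP.
by rewrite scaler_eq0 dnorm_eq0 (negPf p0) => /eqP.
Qed.

Definition vector_form (v : H) x y : R[i] := hs_dot H (hm_ip x y v) v.

Lemma vector_form_sesquilinear v : sesquilinear_form (vector_form v).
Proof.
have lin x : scalar (vector_form v x).
  by move=> k y z; rewrite /vector_form hm_ip_linear /= linearPl.
have herm x y : vector_form v x y = (vector_form v y x)^*.
  by rewrite /vector_form hm_ip_adj [LHS]hermC expr0 mul1r.
by split=> // y k x x'; rewrite herm lin rmorphD rmorphM /= -!herm.
Qed.

Lemma vector_form_ge0 v x : 0 <= vector_form v x x.
Proof.
rewrite /vector_form; have [b [c [_ _ bc ->]]] := hm_ip_ge0 x.
rewrite /=; have := bc v (b v).
rewrite [X in _ = X]hermC expr0 mul1r => /(congr1 Num.conj); rewrite conjCK => <-.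
by rewrite conj_ge0.
Qed.
End Module.

(** * Local orthogonality preserving maps *)

Section LocalOrth.
Variables (E F : hilbertModule A) (Psi : {linear E -> F}).
Hypotheses (Psi_local : local_map Psi) (Psi_orth : orthogonality_preserving Psi).

(** As [e] kills [x - x e], locality gives [Psi(x) e = Psi(x e) e]. To remove the last [e] without a
    unit in [A], use that [b - e b] kills [x e] for every [b] in [A]. *)
Lemma local_map_idempotent x e : A e -> e \o e = e ->
  Psi (hm_act x e) = hm_act (Psi x) e.
Proof.
move=> Ae ee; have AC := hA.1.
have eq_act (y : E) :
  hm_act (y - hm_act y e) e = 0 -> hm_act (Psi y) e = hm_act (Psi (hm_act y e)) e.
  by move=> /(Psi_local Ae); rewrite linearB hm_actBl // => /subr0_eq.
rewrite [RHS]eq_act; last by rewrite hm_actBl // -hm_actM // ee subrr.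
apply/eqP; rewrite -subr_eq0; apply/eqP/hm_act_eq0 => b Ab.
have Aeb : A (e \o b) by exact: cstarM.
rewrite hm_actBl // -hm_actM // -hm_actBr //; apply: Psi_local.
  by rewrite -scaleN1r; apply: cstarD => //; exact: cstarZ.
by rewrite hm_actBr // -!hm_actM // compA ee subrr.
Qed.

Lemma local_map_rank_one x u v :
  Psi (hm_act x (rank_one u v)) = hm_act (Psi x) (rank_one u v).
Proof.
have AC := hA.1.
wlog uv0 : u / hs_dot H u v != 0 => [gen|].
  have [uv|/gen//] := eqVneq (hs_dot H u v) 0.
  have [->|v0] := eqVneq v 0.
    (* The zero operator is written as a zero multiple so that homogeneity of the action applies. *)
    have -> : rank_one u (0 : H) = (0 : R[i]) *: rank_one u (0 : H).
      by apply/funext => p; rewrite /rank_one /= linear0r !scale0r.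
    by rewrite !hm_actZr // !scale0r linear0.
  have vv : hs_dot H v v != 0 by rewrite dnorm_eq0.
  have /gen : hs_dot H (u + v) v != 0 by rewrite linearDl /= uv add0r.
  by rewrite rank_oneDl !hm_actDr // linearD (gen v) // => /addIr.
set c := hs_dot H u v in uv0.
have -> : rank_one u v = c *: (c^-1 *: rank_one u v).
  by rewrite scalerA divff // scale1r.
have Ae : A (c^-1 *: rank_one u v) by exact: cstarZ.
rewrite !(hm_actZr c) // linearZ /= local_map_idempotent //.
apply/funext => p; rewrite /rank_one /= !scalrfctE linearZl_LR /= linearZl_LR /= -/c.
by rewrite mulrCA mulVf ?mulr1.
Qed.

Lemma vector_form_orth v x y :
  vector_form v x y = 0 -> vector_form v (Psi x) (Psi y) = 0.
Proof.
have [->|v0 sxy] := eqVneq v 0; first by rewrite /vector_form !linear0r.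
have : hm_ip (hm_act x (rank_one v v)) (hm_act y (rank_one v v)) = 0.
  apply/funext => p; apply/eqP; rewrite -(dnorm_eq0 (hs_dot H)) dot_ip_rank_one.
  by rewrite -/(vector_form v x y) sxy mulr0.
move=> /Psi_orth; rewrite !local_map_rank_one => /(congr1 (fun f => hs_dot H (f v) v)).
rewrite dot_ip_rank_one /= linear0l => /eqP.
by rewrite !mulf_eq0 fmorph_eq0 dnorm_eq0 (negPf v0) => /eqP.
Qed.

Lemma vector_form_proportional v : exists2 lambda : R, 0 <= lambda &
  forall x y, vector_form v (Psi x) (Psi y) = lambda%:C * vector_form v x y.
Proof.
have sform := @vector_form_sesquilinear E v.
have tform := @vector_form_sesquilinear F v.
have [s0|] := pselect (forall x : E, vector_form v x x = 0).
  exists 0 => // x y; rewrite mul0r; apply: vector_form_orth.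
  exact: sesquilinear_form_polar.
move=> /existsNP[x0 /eqP s0].
(* This ratio makes the form [t - lambda s] vanish at [(x0, x0)], where [s] does not. *)
set lambda := vector_form v (Psi x0) (Psi x0) / vector_form v x0 x0.
have lambda_ge0 : 0 <= lambda by rewrite divr_ge0 // vector_form_ge0.
exists (complex.Re lambda).
  by rewrite -ler0c RRe_real // ger0_real.
rewrite RRe_real ?ger0_real // => x y; apply/eqP; rewrite -subr_eq0; apply/eqP.
move: x y; apply: (@sesquilinear_form_eq0 _ _ (vector_form v) _ sform _ _ x0 x0) => //.
- case: sform tform => sr sl [tr tl]; split=> [x k y z|y k x x'].
    by rewrite linearP tr sr /=; ring.
  by rewrite linearP tl sl /=; ring.
- by move=> x y sxy; rewrite vector_form_orth // sxy mulr0 subrr.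
- by rewrite divfK // subrr.
Qed.
End LocalOrth.
End HilbertModule.

Theorem corollary3p2 (R : realType) (H : hilbertSpace R) (A : set (H -> H))
    (hA : standard_cstar_algebra A) (E F : hilbertModule A)
    (Psi : {linear E -> F})
    (Psi_local : local_map Psi)
    (Psi_orth : orthogonality_preserving Psi) :
  exists2 lambda : R, 0 <= lambda &
    forall x y : E, hm_ip (Psi x) (Psi y) = lambda%:C *: hm_ip x y.
Proof.
have [[v v0]|] := pselect (exists v : H, v != 0); last first.
  move=> /forallNP H0; exists 0 => // x y; apply/funext => p.
  have H0' (w : H) : w = 0 by apply/eqP/negPn/negP/H0.
  by rewrite [LHS]H0' [RHS]H0'.
have [lambda lambda_ge0 prop] := vector_form_proportional hA Psi_local Psi_orth v.
exists lambda => // x y; apply/funext => w; apply/eqP.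
rewrite -subr_eq0 -(dnorm_eq0 (hs_dot H)); apply/eqP.
(* Taking the defect at [w] itself as the test vector [u] turns equality of matrix entries into
   [<u, u> = 0]. *)
set u := _ - _.
have vv : hs_dot H v v * (hs_dot H v v)^* != 0.
  by rewrite mulf_eq0 fmorph_eq0 dnorm_eq0 orbb.
have := prop (hm_act x (rank_one u v)) (hm_act y (rank_one w v)).
rewrite /vector_form !(local_map_rank_one hA) // !(dot_ip_rank_one hA) mulrCA => /(mulfI vv).
by rewrite {2}/u linearBl /= scalrfctE linearZl_LR /= => ->; rewrite subrr.
Qed.
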